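(* Let $X\subset\mathbb{R}^n$ be a nonempty polytope, let $K\ge 1$, and for each $k\in[K]$ let $f_k(x)=\max\{a^{ki\top}x+b^{ki} : i\in[I_k]\}$ be a piecewise-linear convex function with finitely many pieces. Consider the problem $$\max_{x\in X}\ \min_{k\in[K]}\ \max\{a^{ki\top}x+b^{ki} : i\in[I_k]\}. \qquad (\mathrm{PL})$$ The geometric branch-and-bound algorithm (GB2, described in the context) applied to (PL) terminates in finitely many (outer) iterations and returns a global maximizer (global optimal solution) of (PL).
   Context: Notation: $[m]=\{1,\dots,m\}$; $a^{ki}\in\mathbb{R}^n$, $b^{ki}\in\mathbb{R}$; $f(x)=\min_{k\in[K]}f_k(x)$. For $k\in[K]$, $i\in[I_k]$ let $$Q^{ki}=\{x\in X : a^{ki\top}x+b^{ki}\ge a^{kj\top}x+b^{kj}\ \ \forall j\in[I_k]\setminus\{i\}\}.$$ Nodes. The algorithm manages a rooted tree. A node $P$ is identified with a polytope $P\subseteq X$ and carries branching information $\mathcal{J}[P]=\{(k_s,i_s)\}_{s=1}^{l}$ with $k_s\in[K]$, $i_s\in[I_{k_s}]$, where $P=\bigcap_{s=1}^l Q^{k_si_s}$ (and $P=X$ if $\mathcal{J}[P]=\emptyset$). Put $\mathcal{K}[P]=\{k_s\}_{s=1}^{l}$; $l$ is the level of $P$. GB2 algorithm. Initialization: the root node is $P^0=X$ with $\mathcal{J}[P^0]=\emptyset$; set $L\gets-\infty$, $U\gets+\infty$ (and $U[P^0]=+\infty$, $L[P^0]=-\infty$). While $L<U$, perform the following (outer) iteration.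 1. Branching node selection: pick a leaf $P$ of the current tree with $U[P]=\max\{U[P'] : P' \text{ is a leaf of the current tree}\}$; let $l$ be its level. 2. Function selection: let $k_{l+1}$ be an arbitrary index in $[K]\setminus\mathcal{K}[P]$. 3. Branching: create $I_{k_{l+1}}$ child nodes $P_i$, $i\in[I_{k_{l+1}}]$, of $P$, with $\mathcal{J}[P_i]=\mathcal{J}[P]\cup\{(k_{l+1},i)\}$ and $P_i=P\cap Q^{k_{l+1}i}$; empty children are discarded. 4. Bound evaluation: for each new $P_i$ solve the linear program $$\max\{\theta : \theta\le a^{kj\top}x+b^{kj}\ \ \forall (k,j)\in\mathcal{J}[P_i],\ x\in P_i\}$$ and let $(\theta^i,x^i)$ be an optimal solution. Set $U[P_i]\gets\theta^i$, $L[P_i]\gets f(x^i)$, $x_{P_i}\gets x^i$. Set $L\gets\max\{L[P'] : P'\text{ is a leaf}\}$ and $U\gets\max\{U[P'] : P'\text{ is a leaf}\}$. 5. Pruning: for each current leaf $P$: if $U[P]\le L$, prune the node $P$; if $L[P]=U$, set $L\gets L[P]$, $x^*\gets x_P$ and stop. The algorithm returns $x^*$. *)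

(* Defs.v *)
From HB Require Import structures.
From Stdlib Require Export Relation_Operators.
From mathcomp Require Export all_boot all_order all_algebra.
From mathcomp Require Export all_classical all_reals all_analysis.
Export numFieldNormedType.Exports.

Set Implicit Arguments.
Unset Strict Implicit.
Unset Printing Implicit Defensive.

Import Order.TTheory GRing.Theory Num.Theory.

Open Scope classical_set_scope.
Open Scope ring_scope.

Definition polytope (R : realType) (n : nat) (X : set 'rV[R]_n) : Prop :=
  (exists (m : nat) (A : 'I_m -> 'rV[R]_n) (c : 'I_m -> R),
      X = [set x | forall i : 'I_m, \sum_(j < n) A i 0 j * x 0 j <= c i])
  /\ bounded_set X.

(* Index pairs (k, i) with k in [K] and i in [I_k]. *)
Definition piece (K : nat) (I : 'I_K -> nat) : finType :=
  {k : 'I_K & 'I_(I k)}.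

(* A node P is represented by its branching information J[P].  Siblings differ
   in the piece chosen for one and the same function, and no function is used
   twice on a path, so distinct nodes of a tree have distinct J[P], and the
   descendants of P are exactly the nodes whose J properly contains J[P]. *)
Definition node (K : nat) (I : 'I_K -> nat) : finType := {set piece I}.

Section Problem.
Context (R : realType) (n K : nat) (I : 'I_K -> nat).
Context (a : forall k : 'I_K, 'I_(I k) -> 'rV[R]_n).
Context (b : forall k : 'I_K, 'I_(I k) -> R).
Context (X : set 'rV[R]_n).

Definition affine (k : 'I_K) (i : 'I_(I k)) (x : 'rV[R]_n) : R :=
  \sum_(j < n) a i 0 j * x 0 j + b i.

(* The maximum and minimum are taken in \bar R, where the empty ones are -oo
   and +oo; they are finite as soon as K and all the I k are positive. *)
Definition fk (k : 'I_K) (x : 'rV[R]_n) : \bar R :=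
  \big[maxe/-oo%E]_(i < I k) (affine i x)%:E.

Definition f (x : 'rV[R]_n) : \bar R := \big[mine/+oo%E]_(k < K) fk k x.

Definition global_maximizer (x : 'rV[R]_n) : Prop :=
  X x /\ (forall y, X y -> (f y <= f x)%E).

Definition Q (k : 'I_K) (i : 'I_(I k)) : set 'rV[R]_n :=
  [set x | X x /\ forall j, j != i -> affine j x <= affine i x].

Definition node_polytope (P : node I) : set 'rV[R]_n :=
  [set x | X x /\ forall ki, ki \in P -> Q (tagged ki) x].

Definition node_functions (P : node I) : {set 'I_K} :=
  [set tag ki | ki in P].

Definition lp_feasible (P : node I) (theta : R) (x : 'rV[R]_n) : Prop :=
  node_polytope P x /\ forall ki, ki \in P -> theta <= affine (tagged ki) x.

Definition lp_optimal (P : node I) (theta : R) (x : 'rV[R]_n) : Prop :=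
  lp_feasible P theta x /\
  forall theta' x', lp_feasible P theta' x' -> theta' <= theta.

Definition children (P : node I) (k : 'I_K) : {set node I} :=
  [set ki |: P | ki : piece I &
     (tag ki == k) && `[< node_polytope (ki |: P) !=set0 >]].

(* [ub], [lb], [pt] are the arrays U[P], L[P], x_P; only their values on [tree]
   matter.  [globL] and [globU] are the scalars L and U.  A pruned node stays in the tree as a leaf, and so keeps taking part
   in the maxima defining L and U and in the stopping test, but it is never
   branched again.  (L is recomputed from the leaves, not kept as an incumbent:
   if pruned nodes were erased, the best known point could be lost.) *)
Record state := State {
  tree : {set node I};
  pruned : {set node I};
  ub : node I -> \bar R;
  lb : node I -> \bar R;
  pt : node I -> option 'rV[R]_n;
  globL : \bar R;
  globU : \bar R }.

Definition leaves (T : {set node I}) : {set node I} :=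
  [set P in T | [forall P' in T, ~~ (P \proper P')]].

Definition init_state : state :=
  State [set finset.set0] finset.set0 (fun=> +oo%E) (fun=> -oo%E) (fun=> None)
    -oo%E +oo%E.

(* Each arbitrary choice of the algorithm is made in a transition of its own, so
   that a choice leaving the algorithm without a next move shows up as a stuck
   configuration.  One outer iteration takes five transitions. *)
Inductive config :=
| Loop of state                    (* test of the while condition *)
| Selected of state & node I       (* P has been selected *)
| Chosen of state & node I & 'I_K  (* k_{l+1} has been selected *)
| Branched of state & {set node I} (* new nodes have been created *)
| Evaluated of state               (* bounds have been updated *)
| Returned of option 'rV[R]_n.     (* [None]: x^* was never assigned *)

Definition add_nodes (s : state) (C : {set node I}) : state :=
  State (tree s :|: C) (pruned s) (ub s) (lb s) (pt s) (globL s) (globU s).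

Definition set_bounds (s : state) (C : {set node I})
    (theta : node I -> R) (x : node I -> 'rV[R]_n) : state :=
  let ub' P := if P \in C then (theta P)%:E else ub s P in
  let lb' P := if P \in C then f (x P) else lb s P in
  let pt' P := if P \in C then Some (x P) else pt s P in
  State (tree s) (pruned s) ub' lb' pt'
    (\big[maxe/-oo%E]_(P in leaves (tree s)) lb' P)
    (\big[maxe/-oo%E]_(P in leaves (tree s)) ub' P).

Definition prune (s : state) : state :=
  State (tree s)
    (pruned s :|: [set P in leaves (tree s) | (ub s P <= globL s)%E])
    (ub s) (lb s) (pt s) (globL s) (globU s).

Inductive step : config -> config -> Prop :=
| step_exit s : ~ (globL s < globU s)%E -> step (Loop s) (Returned None)
| step_select s P :
    (globL s < globU s)%E ->
    P \in leaves (tree s) -> P \notin pruned s ->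
    (forall P', P' \in leaves (tree s) -> (ub s P' <= ub s P)%E) ->
    step (Loop s) (Selected s P)
| step_choose s P k :
    k \notin node_functions P -> step (Selected s P) (Chosen s P k)
| step_branch s P k :
    step (Chosen s P k)
         (Branched (add_nodes s (children P k)) (children P k))
| step_evaluate s (C : {set node I}) theta x :
    (forall P, P \in C -> lp_optimal P (theta P) (x P)) ->
    step (Branched s C) (Evaluated (set_bounds s C theta x))
| step_stop s P :
    P \in leaves (tree s) -> lb s P = globU s ->
    step (Evaluated s) (Returned (pt s P))
| step_prune s :
    (forall P, P \in leaves (tree s) -> lb s P <> globU s) ->
    step (Evaluated s) (Loop (prune s)).

Definition init : config := Loop init_state.

Definition reachable (c : config) : Prop := clos_refl_trans config step init c.

End Problem.

(* Main.v *)
From Stdlib Require Import Operators_Properties.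
Require Import Defs.

(* On a node [P] every piece in [J[P]] is active, so the linear program maximizes
   the minimum of the [f_k] already used; hence [U[P]] dominates [f] on [P], with
   [L[P] = U[P]] once every function has been used.  As the leaves cover [X] at
   all times, [L <= v <= U] for the optimal value [v].  Each round adds a node to
   a tree with finitely many possible nodes, whence termination.  The delicate
   point is that a leaf attaining [U] can always be selected while [L < U]: see
   [has_witness] below. *)

Set Implicit Arguments.
Unset Strict Implicit.
Unset Printing Implicit Defensive.

Import Order.TTheory GRing.Theory Num.Theory.

(** * Continuity, compactness and the linear programs at nodes *)

Lemma continuous_bigmin (R : realType) (T : topologicalType) (J : Type)
    (r : seq J) (P : pred J) (g0 : T -> R^o) (g : J -> T -> R^o) :
  continuous g0 -> (forall j, continuous (g j)) ->
  continuous (fun x => \big[Order.min/g0 x]_(j <- r | P j) g j x : R^o).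
Proof.
move=> g0c gc; elim: r => [|j r IHr].
  rewrite [X in continuous X](_ : _ = g0)//.
  by apply/funext => x; rewrite big_nil.
rewrite [X in continuous X](_ : _ = if P j
    then g j \min (fun x => \big[Order.min/g0 x]_(j <- r | P j) g j x)
    else (fun x => \big[Order.min/g0 x]_(j <- r | P j) g j x)); last first.
  by apply/funext => x; rewrite big_cons; case: ifP.
by case: ifP => // _ x; apply: continuous_min; [exact: gc|exact: IHr].
Qed.

Section LinearPrograms.
Context (R : realType) (n K : nat) (I : 'I_K -> nat).
Context (a : forall k : 'I_K, 'I_(I k) -> 'rV[R]_n).
Context (b : forall k : 'I_K, 'I_(I k) -> R).
Context (X : set 'rV[R]_n).
Context (polytopeX : polytope X).
Context (X_neq0 : exists x, X x).
Context (K_gt0 : (0 < K)%N).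
Context (I_gt0 : forall k : 'I_K, (0 < I k)%N).

Local Notation aff := (affine a b).
Local Notation np := (node_polytope a b X).

Lemma continuous_dot (m : nat) (u : 'rV[R]_m) :
  continuous (fun x : 'rV[R]_m => \sum_(j < m) u 0 j * x 0 j : R^o).
Proof.
apply: continuous_big => [|j _]; first exact: tvs.add_continuous.
move=> x; apply: (@continuousM _ _ (fun=> u 0 j) (fun y : 'rV[R]_m => y 0 j)).
  exact: cst_continuous.
exact: coord_continuous.
Qed.

Lemma continuous_affine (k : 'I_K) (i : 'I_(I k)) : continuous (aff i : _ -> R^o).
Proof. move=> x; exact: (cvgD (@continuous_dot n (a i) x) (@cst_continuous _ _ (b i) x)). Qed.

Lemma closed_polytope (m : nat) (Y : set 'rV[R]_m) : polytope Y -> closed Y.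
Proof.
move=> [[p [A [c ->]]] _].
rewrite [X in closed X](_ : _ = \bigcap_(i in [set: 'I_p])
   (fun x : 'rV[R]_m => \sum_(j < m) A i 0 j * x 0 j) @^-1` [set y | y <= c i]).
  apply: closed_bigI => i _; move/continuous_closedP: (@continuous_dot m (A i)).
  by apply; exact: closed_le.
by apply/seteqP; split=> x /= h i => [_|]; exact: h.
Qed.

Lemma closed_Q (k : 'I_K) (i : 'I_(I k)) : closed (Q a b X i).
Proof.
rewrite [X in closed X](_ : _ = X `&` \bigcap_(j in [set j | j != i])
   (fun x => aff i x - aff j x) @^-1` [set y | 0 <= y]).
  apply: closedI; first exact: closed_polytope.
  apply: closed_bigI => j _.
  have /continuous_closedP : continuous (fun x => aff i x - aff j x : R^o).
    by move=> x; exact: (cvgB (@continuous_affine k i x) (@continuous_affine k j x)).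
  by apply; exact: closed_ge.
by apply/seteqP; split=> x /= [Xx h]; split=> // j /h; rewrite /= subr_ge0.
Qed.

Lemma compact_node_polytope (P : node I) : compact (np P).
Proof.
have [_ Xb] := polytopeX.
apply: (@subclosed_compact _ _ X); last by move=> x [].
  rewrite [X in closed X](_ : _ = X `&` \bigcap_(ki in [set` P]) Q a b X (tagged ki)) //.
  apply: closedI; first exact: closed_polytope.
  by apply: closed_bigI => ki _; exact: closed_Q.
by apply: bounded_closed_compact => //; exact: closed_polytope.
Qed.

(** For fixed [x] the best [theta] is the least of the pieces in [P], so the program maximizes a
    continuous function over a compact set. With [P] empty, [theta] would be unbounded. *)
Lemma lp_optimum_exists (P : node I) :
  P != finset.set0 -> np P !=set0 -> exists theta x, lp_optimal a b X P theta x.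
Proof.
move=> /set0Pn[ki0 ki0P] P0.
(* The default value is itself one of the terms, so it does not alter the minimum. *)
pose g x := \big[Order.min/aff (tagged ki0) x]_(ki in P) aff (tagged ki) x.
have gc : continuous (g : _ -> R^o).
  by apply: continuous_bigmin => [|ki]; exact: continuous_affine.
have [x /set_mem Px xmax] := compact_EVT_max P0 (@compact_node_polytope P)
  (continuous_subspaceT gc).
exists (g x), x; split; first by split=> // ki kiP; exact: bigmin_le_cond.
move=> theta y [Py hy]; apply: le_trans (xmax y _); last exact/mem_set.
by apply: le_bigmin => //; exact: hy.
Qed.

(** Any piece attaining the maximum at [x] will do. Hence branching on [k] loses no point of [X]. *)
Lemma active_piece (k : 'I_K) (x : 'rV[R]_n) :
  X x -> exists i : 'I_(I k), Q a b X i x.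
Proof.
move=> Xx; case: (arg_maxP (fun i => aff i x) (isT : xpredT (Ordinal (I_gt0 k)))) => i _ h.
by exists i; split=> // j _; exact: h.
Qed.

Lemma fk_Q (k : 'I_K) (i : 'I_(I k)) (x : 'rV[R]_n) :
  Q a b X i x -> fk a b k x = (aff i x)%:E.
Proof.
move=> [_ h]; apply/eqP; rewrite eq_le le_bigmax andbT.
apply: bigmax_le => [|j _]; first exact: leNye.
by rewrite lee_fin; have [->//|/h] := eqVneq j i.
Qed.

Lemma f_le_affine (P : node I) (x : 'rV[R]_n) :
  np P x -> forall ki, ki \in P -> (f a b x <= (aff (tagged ki) x)%:E)%E.
Proof. by move=> [_ h] ki /h/fk_Q <-; exact: bigmin_le. Qed.

Lemma f_fin_num (x : 'rV[R]_n) : X x -> f a b x \is a fin_num.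
Proof.
move=> Xx; rewrite fin_numElt; apply/andP; split.
  apply: lt_bigmin => [|k _]; first by [].
  by have [i /fk_Q ->] := active_piece k Xx; exact: ltNyr.
apply: le_lt_trans (bigmin_le _ (Ordinal K_gt0) _) _.
by have [i /fk_Q ->] := active_piece (Ordinal K_gt0) Xx; exact: ltry.
Qed.

(** The pair [(f y, y)] is feasible: on the node each chosen piece equals its [f_k], which is at
    least [f]. *)
Lemma f_le_lp (P : node I) (theta : R) (x y : 'rV[R]_n) :
  lp_optimal a b X P theta x -> np P y -> (f a b y <= theta%:E)%E.
Proof.
move=> [_ opt] Py; have [Xy _] := Py.
rewrite -(fineK (f_fin_num Xy)) lee_fin; apply: (opt _ y); split=> // ki kiP.
by rewrite -lee_fin fineK ?f_fin_num//; exact: (f_le_affine Py).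
Qed.

(** Each [f_k] is at least its piece in [P], and that piece is at least [theta]. *)
Lemma lp_le_f (P : node I) (theta : R) (x : 'rV[R]_n) :
  node_functions P = [set: 'I_K]%SET -> lp_feasible a b X P theta x ->
  (theta%:E <= f a b x)%E.
Proof.
move=> Pfull [_ h]; apply: le_bigmin => [|k _]; first exact: leey.
have : k \in node_functions P by rewrite Pfull inE.
case/imsetP => -[k' i] /h /= thi /= ->.
by apply: (bigmax_sup i) => //; rewrite lee_fin.
Qed.

(* The set of all pieces active at [y] is a full node whose optimal LP value is
   at least [f y]: the maximum of [f] is the best of finitely many LP optima. *)
Lemma global_maximizer_exists : exists x, global_maximizer a b X x.
Proof.
pose act y : node I := [set ki | `[< Q a b X (tagged ki) y >]]%SET.
have actP y : X y -> np (act y) y by move=> Xy; split=> // ki; rewrite inE => /asboolP.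
have act_full y : X y -> node_functions (act y) = [set: 'I_K]%SET.
  move=> Xy; apply/setP => k; rewrite inE; have [i iy] := active_piece k Xy.
  by apply/imsetP; exists (existT _ k i); rewrite // inE; apply/asboolP.
have act_neq0 y : X y -> act y != finset.set0.
  move=> /act_full ay; apply: contra_eq_neq ay => ->.
  rewrite /node_functions imset0 eq_sym; apply/set0Pn.
  by exists (Ordinal K_gt0); rewrite inE.
pose good P := (P != finset.set0) && `[< np P !=set0 >].
have /choice[x xP] (P : node I) : exists x, good P -> exists theta, lp_optimal a b X P theta x.
  case: (boolP (good P)) => [/andP[P0 /asboolP]|_]; last by exists 0.
  by move=> /(lp_optimum_exists P0)[theta [x ?]]; exists x => _; exists theta.
have goodP y : X y -> good (act y).
  by move=> Xy; rewrite /good act_neq0//=; apply/asboolP; exists y; exact: actP.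
have [y0 Xy0] := X_neq0.
case: (arg_maxP (fun P => f a b (x P)) (goodP _ Xy0)) => P goodPP Pmax.
exists (x P); split=> [|y Xy].
  by have [theta [[[]]]] := xP _ goodPP.
(* With [A := act y], the chain is [f y <= theta <= f (x A) <= f (x P)]; the middle step holds
   because [A] uses every function. *)
apply: le_trans (Pmax _ (goodP _ Xy)).
have [theta opt] := xP _ (goodP _ Xy).
apply: le_trans (f_le_lp opt (actP _ Xy)) _.
by apply: lp_le_f (act_full _ Xy) _; case: opt.
Qed.

End LinearPrograms.

(** * Branching trees encoded by inclusion *)

Section Trees.
Context (R : realType) (n K : nat) (I : 'I_K -> nat).
Context (a : forall k : 'I_K, 'I_(I k) -> 'rV[R]_n).
Context (b : forall k : 'I_K, 'I_(I k) -> R).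
Context (X : set 'rV[R]_n).
Context (X_neq0 : exists x, X x).
Context (I_gt0 : forall k : 'I_K, (0 < I k)%N).

Local Notation np := (node_polytope a b X).
Local Notation children := (children a b X).
Implicit Types (P : node I) (T : {set node I}) (k : 'I_K).

(** Since a path uses each function at most once, conflicting nodes lie on different branches, and
    their descendants conflict too. *)
Definition conflict P P' : Prop :=
  exists ki kj, [/\ ki \in P, kj \in P', tag ki = tag kj & ki != kj].

(** No parent pointers are kept: ancestry is inclusion. [tree_compare] and [tree_inj] ensure that
    the children of a leaf do not land below another leaf. *)
Record branching_tree T : Prop := BranchingTree {
  tree_nonempty : forall P, P \in T -> np P !=set0;
  tree_inj : forall P, P \in T -> {in P &, injective (fun ki => tag ki)};
  tree_compare : forall P P', P \in T -> P' \in T ->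
    [\/ P \subset P', P' \subset P | conflict P P'];
  tree_cover : forall x, X x -> exists2 P, P \in leaves T & np P x }.

Lemma leavesP T P :
  reflect (P \in T /\ forall P', P' \in T -> P \subset P' -> P' = P)
          (P \in leaves T).
Proof.
rewrite inE; apply: (iffP andP) => -[PT h]; split=> //.
  move=> P' P'T PP'; have /forallP/(_ P') := h; rewrite P'T/= properE PP'/= negbK.
  by move=> P'P; apply/eqP; rewrite finset.eqEsubset P'P.
apply/forallP => P'; apply/implyP => P'T; apply/negP => /properP[PP' [x]].
by rewrite (h P' P'T PP') => ->.
Qed.

Lemma childrenP P k C :
  reflect (exists2 ki, tag ki = k & C = ki |: P /\ np C !=set0)
          (C \in children P k).
Proof.
apply: (iffP imsetP) => [[ki /[!inE] /andP[/eqP kik /asboolP ne] ->]|[ki kik [-> ne]]].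
  by exists ki.
by exists ki => //; rewrite inE kik eqxx /=; apply/asboolP.
Qed.

Lemma node_polytopeU1 P ki x :
  np P x -> Q a b X (tagged ki) x -> np (ki |: P) x.
Proof. by move=> [Xx h] hki; split=> // kj /setU1P[->//|]; exact: h. Qed.

(** The child for a piece active at [x] contains [x], hence is not discarded as empty. *)
Lemma children_cover P k x :
  np P x -> exists2 C : node I, C \in children P k & np C x.
Proof.
move=> Px; have [i ix] := active_piece a b I_gt0 k (proj1 Px).
have Cx := node_polytopeU1 (ki := existT _ k i) Px ix.
exists (existT _ k i |: P) => //; apply/childrenP; exists (existT _ k i) => //.
by split=> //; exists x.
Qed.

Lemma notin_node_functions P k ki : k \notin node_functions P -> ki \in P -> tag ki != k.
Proof. by move=> kP kiP; apply: contraNneq kP => <-; exact: imset_f. Qed.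

Lemma branching_tree_root : branching_tree [set finset.set0]%SET.
Proof.
have np0 x : X x -> np (finset.set0 : node I) x by move=> Xx; split=> // ki; rewrite inE.
split=> [P /set1P->|P /set1P-> ?|P P' /set1P-> _|x Xx].
- by have [x /np0] := X_neq0; exists x.
- by rewrite inE.
- by constructor 1; exact: finset.sub0set.
- by exists finset.set0; [apply/leavesP; split=> [|P' /set1P]; rewrite ?inE|exact: np0].
Qed.

Section Branch.
Context (T : {set node I}) (P : node I) (k : 'I_K).
Context (treeT : branching_tree T) (leafP : P \in leaves T) (kP : k \notin node_functions P).

Let PT : P \in T. Proof. by case/leavesP: leafP. Qed.

Lemma child_sup C : C \in children P k -> P \proper C.
Proof.
move=> /childrenP[ki kik [-> _]]; rewrite properE subsetU1 finset.subUset finset.sub1set.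
rewrite subxx andbT; apply/negP => /(notin_node_functions kP).
by rewrite kik eqxx.
Qed.

Lemma child_notin C : C \in children P k -> C \notin T.
Proof.
move=> /child_sup CP; apply/negP => CT; have [_ /(_ C CT (proper_sub CP)) CE] := leavesP _ _ leafP.
by move: CP; rewrite CE fintype.properxx.
Qed.

(** A leaf is maximal, so comparing [P'] with [P] leaves inclusion in [P] or a conflict; the latter
    passes to the larger set [C]. *)
Lemma child_compare C P' : C \in children P k -> P' \in T ->
  P' \subset P \/ conflict C P'.
Proof.
move=> Cch P'T; have CP := proper_sub (child_sup Cch).
have [PP'|P'P|[ki [kj [kiP kjP' tij ij]]]] := tree_compare treeT PT P'T.
- by left; have [_ /(_ P' P'T PP') ->] := leavesP _ _ leafP.
- by left.
- by right; exists ki, kj; split=> //; exact: (fintype.subsetP CP).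
Qed.

Lemma conflict_sym (A B : node I) : conflict A B -> conflict B A.
Proof. by move=> [u [v [uA vB uv nuv]]]; exists v, u; rewrite eq_sym. Qed.

Lemma children_compare C C' : C \in children P k -> C' \in children P k ->
  C = C' \/ conflict C C'.
Proof.
move=> /childrenP[ki kik [-> _]] /childrenP[kj kjk [-> _]].
have [->|ij] := eqVneq ki kj; first by left.
by right; exists ki, kj; split; rewrite ?setU11// kik.
Qed.

Lemma child_inj (C : node I) : C \in children P k -> {in C &, injective (fun ki => tag ki)}.
Proof.
move=> /childrenP[ki kik [-> _]] u v /setU1P[->|uP] /setU1P[->|vP] //= uv.
- by have := notin_node_functions kP vP; rewrite -uv kik eqxx.
- by have := notin_node_functions kP uP; rewrite uv kik eqxx.
- exact: (tree_inj treeT PT).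
Qed.

Lemma conflict_nsub (C P' : node I) : {in C &, injective (fun ki => tag ki)} ->
  conflict C P' -> ~~ (P' \subset C).
Proof.
move=> Cinj [u [v [uC vP' uv nuv]]]; apply/negP => /fintype.subsetP/(_ v vP') vC.
by move: nuv; rewrite (Cinj u v) ?eqxx.
Qed.

(** [P] stops being a leaf because it has a nonempty child; any other leaf conflicts with every
    child and so stays maximal. *)
Lemma leaves_branch :
  leaves (T :|: children P k) = (leaves T :\ P) :|: children P k.
Proof.
apply/setP => L; apply/leavesP/idP => [[]|].
  move=> /setUP[LT Lmax|Lch _]; last by apply/setUP; right.
  apply/setUP; left; apply/setD1P; split; last first.
    by apply/leavesP; split=> // P' P'T; apply: Lmax; apply/setUP; left.
  apply/eqP => LP; have [x Px] := tree_nonempty treeT PT.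
  have [C Cch _] := children_cover k Px.
  have := child_notin Cch; rewrite (Lmax C) ?LT//; first by apply/setUP; right.
  by rewrite LP; exact: proper_sub (child_sup Cch).
move=> /setUP[/setD1P[LP /leavesP[LT Lmax]]|Lch].
  split=> [|P' /setUP[|P'ch] LP']; [by apply/setUP; left|by move=> /Lmax; exact|].
  have [LsP|/(conflict_nsub (child_inj P'ch))] := child_compare P'ch LT.
    by move: LP; rewrite (Lmax P PT LsP) eqxx.
  by rewrite LP'.
split=> [|P' /setUP[P'T|P'ch] LP']; first by apply/setUP; right.
  (* An old node above a child would lie above [P], hence be [P], a proper subset of the child. *)
  have := child_notin Lch; have [_ /(_ P' P'T) PE] := leavesP _ _ leafP.
  have P'P := PE (fintype.subset_trans (proper_sub (child_sup Lch)) LP').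
  by have := proper_sub_trans (child_sup Lch) LP'; rewrite P'P fintype.properxx.
have [//|/conflict_sym/(conflict_nsub (child_inj P'ch))] := children_compare Lch P'ch.
by rewrite LP'.
Qed.

Lemma branching_tree_branch : branching_tree (T :|: children P k).
Proof.
have mixed (C P' : node I) : C \in children P k -> P' \in T -> P' \subset C \/ conflict C P'.
  move=> Cch P'T; have [P'P|] := child_compare Cch P'T; last by right.
  by left; exact: fintype.subset_trans (proper_sub (child_sup Cch)).
split=> [C /setUP[|]|C /setUP[|]|C C' /setUP[CT|Cch] /setUP[C'T|C'ch]|x Xx].
- exact: (tree_nonempty treeT).
- by move=> /childrenP[ki _ []].
- exact: (tree_inj treeT).
- exact: child_inj.
- exact: (tree_compare treeT).
- by have [|/conflict_sym] := mixed _ _ C'ch CT; [constructor 1|constructor 3].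
- by have [|] := mixed _ _ Cch C'T; [constructor 2|constructor 3].
- by have [->|] := children_compare Cch C'ch; [constructor 1|constructor 3].
rewrite leaves_branch; have [L leafL Lx] := tree_cover treeT Xx.
have [LP|LP] := eqVneq L P; last by exists L => //; apply/setUP; left; apply/setD1P.
have [C Cch Cx] : exists2 C : node I, C \in children P k & np C x.
  by apply: children_cover; rewrite -LP.
by exists C => //; apply/setUP; right.
Qed.

End Branch.
End Trees.

(** * Invariants of the state: bounds, pruning, witnesses *)

Section Algorithm.
Context (R : realType) (n K : nat) (I : 'I_K -> nat).
Context (a : forall k : 'I_K, 'I_(I k) -> 'rV[R]_n).
Context (b : forall k : 'I_K, 'I_(I k) -> R).
Context (X : set 'rV[R]_n).
Context (polytopeX : polytope X).
Context (X_neq0 : exists x, X x).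
Context (K_gt0 : (0 < K)%N).
Context (I_gt0 : forall k : 'I_K, (0 < I k)%N).
Context (v : \bar R).
Context (v_ub : forall y, X y -> (f a b y <= v)%E).
Context (v_attained : exists2 x, X x & f a b x = v).

Local Notation np := (node_polytope a b X).
Local Notation children := (children a b X).
Implicit Types (P : node I) (C : {set node I}) (k : 'I_K) (s : state R n I).

Definition root : node I := finset.set0.
Definition none : {set node I} := finset.set0.

Definition evaluated s P : Prop :=
  exists theta x, [/\ lp_optimal a b X P theta x, ub s P = theta%:E,
                      lb s P = f a b x & pt s P = Some x].

(** The root is never evaluated, as its program leaves [theta] unconstrained; it keeps its initial
    infinite bounds. *)
Definition bounds_ok s P : Prop :=
  if P == root then ub s P = +oo%E /\ lb s P = -oo%E else evaluated s P.

Lemma f_le_ub s P y : bounds_ok s P -> np P y -> (f a b y <= ub s P)%E.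
Proof.
rewrite /bounds_ok; case: ifP => [_ [-> _] _|_ [theta [x [opt -> _ _]]]]; first exact: leey.
exact: f_le_lp opt.
Qed.

Lemma lb_le_v s P : bounds_ok s P -> (lb s P <= v)%E.
Proof.
rewrite /bounds_ok; case: ifP => [_ [_ ->]|_ [theta [x [[[[Xx _] _] _] _ -> _]]]].
  exact: leNye.
exact: v_ub.
Qed.

Lemma lb_le_ub s P : bounds_ok s P -> (lb s P <= ub s P)%E.
Proof.
rewrite /bounds_ok; case: ifP => [_ [_ ->]|_ [theta [x [opt -> -> _]]]].
  exact: leNye.
by apply: f_le_lp (opt) _ => //; case: opt => -[].
Qed.

(* [L] may decrease when its leaf is branched, so a pruned leaf may have an upper
   bound above the current [L].  Such bounds are at most [v <= U], so pruning can
   only block the selection when [U = v].  Then the first kind of witness is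
   itself selectable, and the second, a pruned leaf, stays a leaf for ever and
   forces [L = v]. *)
Definition has_witness s : Prop :=
  (exists P, [/\ P \in leaves (tree s), P \notin pruned s &
     exists2 x, np P x & f a b x = v]) \/
  (exists P, [/\ P \in leaves (tree s), P \in pruned s & lb s P = v]).

(* [C] is the set of nodes that have been created but not yet evaluated. *)
Record state_ok s C : Prop := StateOk {
  ok_tree : branching_tree a b X (tree s);
  ok_bounds : forall P, P \in tree s -> P \notin C -> bounds_ok s P;
  ok_pruned : forall P, P \in pruned s ->
    [/\ P \in tree s, P \notin C & (ub s P <= v)%E];
  ok_witness : has_witness s }.

(** Kept apart from [state_ok]: once children are added, [L] and [U] may be stale until the next
    evaluation. *)
Definition glob_ok s : Prop :=
  globL s = \big[maxe/-oo%E]_(P in leaves (tree s)) lb s P /\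
  globU s = \big[maxe/-oo%E]_(P in leaves (tree s)) ub s P.

Lemma leaf_tree (T : {set node I}) P : P \in leaves T -> P \in T.
Proof. by case/leavesP. Qed.

Lemma leaf_ok s P : state_ok s none -> P \in leaves (tree s) -> bounds_ok s P.
Proof. by move=> ok /leaf_tree PT; apply: (ok_bounds ok); rewrite // inE. Qed.

Lemma leaf_exists s C : state_ok s C -> exists P, P \in leaves (tree s).
Proof.
move=> ok; have [x Xx] := X_neq0.
by have [P leafP _] := tree_cover (ok_tree ok) Xx; exists P.
Qed.

Lemma globL_attained s : state_ok s none -> glob_ok s ->
  exists2 P, P \in leaves (tree s) & lb s P = globL s.
Proof.
move=> /leaf_exists[P0 leafP0] [-> _].
have [|P leafP ->] := eq_bigmax (x := -oo%E) P0 (mem (leaves (tree s))) (lb s) leafP0.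
  by move=> P _; exact: leNye.
by exists P.
Qed.

Lemma globU_attained s : state_ok s none -> glob_ok s ->
  exists2 P, P \in leaves (tree s) & ub s P = globU s.
Proof.
move=> /leaf_exists[P0 leafP0] [_ ->].
have [|P leafP ->] := eq_bigmax (x := -oo%E) P0 (mem (leaves (tree s))) (ub s) leafP0.
  by move=> P _; exact: leNye.
by exists P.
Qed.

Lemma lb_le_globL s P : glob_ok s -> P \in leaves (tree s) -> (lb s P <= globL s)%E.
Proof. by move=> [-> _] leafP; exact: le_bigmax_cond. Qed.

Lemma ub_le_globU s P : glob_ok s -> P \in leaves (tree s) -> (ub s P <= globU s)%E.
Proof. by move=> [_ ->] leafP; exact: le_bigmax_cond. Qed.

Lemma globL_le_v s : state_ok s none -> glob_ok s -> (globL s <= v)%E.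
Proof.
move=> ok gl; have [P leafP <-] := globL_attained ok gl.
by apply: lb_le_v; exact: leaf_ok leafP.
Qed.

Lemma v_le_globU s : state_ok s none -> glob_ok s -> (v <= globU s)%E.
Proof.
move=> ok gl; have [x Xx <-] := v_attained.
have [P leafP Px] := tree_cover (ok_tree ok) Xx.
exact: le_trans (f_le_ub (leaf_ok ok leafP) Px) (ub_le_globU gl leafP).
Qed.

Lemma state_ok_init : state_ok (init_state R n I) none.
Proof.
split=> [|P /set1P-> _|P|]; first exact: branching_tree_root.
- by rewrite /bounds_ok eqxx.
- by rewrite inE.
have [x Xx fx] := v_attained.
have [P leafP Px] := tree_cover (branching_tree_root a b X_neq0) Xx.
by left; exists P; split=> //; [rewrite inE|exists x].
Qed.

Lemma glob_ok_init : glob_ok (init_state R n I).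
Proof.
split; first by rewrite big1_eq.
rewrite [RHS](bigmaxD1 root) ?maxye//=.
by apply/leavesP; split=> [|P' /set1P]; rewrite ?inE.
Qed.

(** Branching a witness of the first kind passes its maximizer to a child, which is new and so not
    pruned. A pruned witness is never the selected leaf. *)
Lemma state_ok_branch s P k : state_ok s none -> P \in leaves (tree s) ->
  P \notin pruned s -> k \notin node_functions P ->
  state_ok (add_nodes s (children P k)) (children P k).
Proof.
move=> ok leafP Pnp kP; have tr := ok_tree ok.
have leavesE := leaves_branch I_gt0 tr leafP kP.
split=> [|Q|Q Qpr|]; first exact: branching_tree_branch.
- by move=> /setUP[QT _|->//]; apply: (ok_bounds ok); rewrite // inE.
- have [QT _ Qv] := ok_pruned ok Qpr; split=> //; first by apply/setUP; left.
  by apply/negP => /(child_notin leafP kP); rewrite QT.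
rewrite /has_witness /= leavesE; case: (ok_witness ok) => -[Q [leafQ Qpr Qw]].
  left; have [QP|QP] := eqVneq Q P; last first.
    by exists Q; split=> //; apply/setUP; left; apply/setD1P.
  have [x Qx fx] := Qw; rewrite QP in Qx.
  have [C Cch Cx] := children_cover I_gt0 k Qx.
  exists C; split; [by apply/setUP; right| |by exists x].
  by apply/negP => /(ok_pruned ok)[CT]; rewrite (negPf (child_notin leafP kP Cch)) in CT.
right; exists Q; split=> //; apply/setUP; left; apply/setD1P; split=> //.
by apply: contraNneq Pnp => <-.
Qed.

(** The root is included in every node, so it is a leaf only while it is alone. Once it is inner,
    every evaluated leaf carries an LP solution. *)
Lemma root_notin_leaves_branch s P k : state_ok s none -> P \in leaves (tree s) ->
  k \notin node_functions P -> root \notin leaves (tree s :|: children P k).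
Proof.
move=> ok leafP kP; rewrite (leaves_branch I_gt0 (ok_tree ok))//.
apply/negP => /setUP[/setD1P[rP /leavesP[_ h]]|/(child_sup kP)].
  by move: rP; rewrite (h P) ?eqxx ?finset.sub0set//; exact: leaf_tree.
by rewrite properE finset.sub0set andbF.
Qed.

Lemma state_ok_evaluate s C theta x : state_ok s C -> root \notin C ->
  (forall P, P \in C -> lp_optimal a b X P (theta P) (x P)) ->
  state_ok (set_bounds a b s C theta x) none.
Proof.
move=> ok rC opt; split=> [|P PT _|P Ppr|]; first exact: ok_tree ok.
- rewrite /bounds_ok; case: (boolP (P \in C)) => PC.
    rewrite ifN; last by apply: contraNneq rC => <-.
    by exists (theta P), (x P); split; rewrite /= ?PC//; exact: opt.
  have := ok_bounds ok PT PC; rewrite /bounds_ok /evaluated /= (negbTE PC).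
  by [].
- have [PT PC Pv] := ok_pruned ok Ppr.
  by split; rewrite ?inE//= (negbTE PC).
case: (ok_witness ok) => -[P [leafP Ppr Pw]]; [left|right]; exists P; split=> //=.
by have [_ PC _] := ok_pruned ok Ppr; rewrite (negbTE PC).
Qed.

(** A newly pruned bound is at most [L <= v]. If an unpruned witness is pruned now, [v <= U[P] <= L
    <= v], and a leaf attaining [L] takes over: of the second kind if pruned, otherwise of the first
    through its LP solution. *)
Lemma state_ok_prune s : state_ok s none -> glob_ok s -> root \notin leaves (tree s) ->
  state_ok (prune s) none.
Proof.
move=> ok gl rl; have Lv := globL_le_v ok gl.
split=> [|P PT _|P|]; first exact: ok_tree ok.
- by apply: (ok_bounds ok); rewrite // inE.
- move=> /setUP[/(ok_pruned ok)//|]; rewrite inE => /andP[leafP PL].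
  by split; [exact: leaf_tree|rewrite inE|exact: le_trans Lv].
case: (ok_witness ok) => -[P [leafP Ppr Pw]]; last first.
  by right; exists P; split=> //; apply/setUP; left.
case: (boolP (P \in pruned (prune s))) => [|Ppr']; last by left; exists P.
move=> /setUP[/(negP Ppr)//|]; rewrite inE => /andP[_ PL].
have [x Px fx] := Pw.
have vL : globL s = v.
  apply/eqP; rewrite eq_le Lv -fx /=; apply: le_trans PL.
  exact: f_le_ub (leaf_ok ok leafP) Px.
have [E leafE LE] := globL_attained ok gl.
case: (boolP (E \in pruned (prune s))) => Epr.
  by right; exists E; split; rewrite // LE.
left; exists E; split=> //; have := leaf_ok ok leafE.
rewrite /bounds_ok ifN; last by apply: contraNneq rl => <-.
by move=> [theta [y [[[Ey _] _] _ fy _]]]; exists y; rewrite // -fy LE.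
Qed.

(** * Configurations: preservation, progress and termination *)

(** At [Loop], [L < U] rules out the exit returning [None]; a remaining [k] keeps [Selected] from
    being stuck; at [Branched], [root \notin C] keeps the programs bounded. *)
Definition config_ok (c : config R n I) : Prop :=
  match c with
  | Loop s => [/\ state_ok s none, glob_ok s & (globL s < globU s)%E]
  | Selected s P => [/\ state_ok s none, P \in leaves (tree s), P \notin pruned s &
      exists k, k \notin node_functions P]
  | Chosen s P k => [/\ state_ok s none, P \in leaves (tree s), P \notin pruned s &
      k \notin node_functions P]
  | Branched s C => [/\ state_ok s C, C \subset tree s, root \notin C &
      root \notin leaves (tree s)]
  | Evaluated s => [/\ state_ok s none, glob_ok s & root \notin leaves (tree s)]
  | Returned o => exists2 x, o = Some x & global_maximizer a b X x
  end.

Lemma config_ok_init : config_ok (init R n I).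
Proof. by split; [exact: state_ok_init|exact: glob_ok_init|]. Qed.

(* On a node that has used every function the linear program is exact, so its
   two bounds agree; a leaf attaining [U] > [L] is therefore not of this kind. *)
Lemma function_remains s P : state_ok s none -> glob_ok s -> (globL s < globU s)%E ->
  P \in leaves (tree s) -> (forall P', P' \in leaves (tree s) -> (ub s P' <= ub s P)%E) ->
  exists k, k \notin node_functions P.
Proof.
move=> ok gl LU leafP Pmax; apply: contrapT => /forallNP full.
have Pfull : node_functions P = [set: 'I_K]%SET.
  by apply/setP => k; rewrite inE; apply/negPn/negP; exact: full.
have := leaf_ok ok leafP; rewrite /bounds_ok; case: eqP => [PE|_].
  by have := full (Ordinal K_gt0); rewrite PE /node_functions imset0 inE.
move=> [theta [x [[feas _] ubP lbP _]]].
have := lp_le_f Pfull feas; rewrite -ubP -lbP => ul.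
have [P' leafP' UE] := globU_attained ok gl.
suff : (globU s <= globL s)%E by rewrite leNgt LU.
rewrite -UE; apply: le_trans (Pmax _ leafP') _.
exact: le_trans ul (lb_le_globL gl leafP).
Qed.

Lemma step_config_ok c c' : config_ok c -> step a b X c c' -> config_ok c'.
Proof.
move=> okc st; case: st okc => {c c'} /=.
- by move=> s nLU [_ _ /nLU].
- move=> s P LU leafP Ppr Pmax [ok gl _]; split=> //.
  exact: function_remains ok gl LU leafP Pmax.
- by move=> s P k kP [ok leafP Ppr _].
- move=> s P k [ok leafP Ppr kP]; split; first exact: state_ok_branch.
  + exact: finset.subsetUr.
  + apply/negP => /(child_sup kP).
    by rewrite properE finset.sub0set andbF.
  + exact: root_notin_leaves_branch.
- move=> s C theta x opt [ok _ rC rl]; split=> //; exact: state_ok_evaluate.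
(* The stopping test gives [f x = U >= v]. *)
- move=> s P leafP LU [ok gl rl]; have := leaf_ok ok leafP.
  rewrite /bounds_ok ifN; last by apply: contraNneq rl => <-.
  move=> [theta [x [[[[Xx _] _] _] _ lbP ->]]]; exists x => //; split=> // y Xy.
  by rewrite -lbP LU; apply: le_trans (v_ub Xy) _; exact: v_le_globU.
(* [L] is attained at a leaf, so [L <= U]; equality would have triggered the stop. *)
- move=> s nLU [ok gl rl]; split; [exact: state_ok_prune|exact: gl|].
  have [P leafP LE] := globL_attained ok gl.
  rewrite lt_neqAle; apply/andP; split.
    by apply/eqP => E; apply: (nLU P leafP); rewrite -E.
  by rewrite -LE; apply: le_trans (lb_le_ub (leaf_ok ok leafP)) (ub_le_globU gl leafP).
Qed.

(** If the leaf attaining [U] is pruned, then [U = v]. An unpruned witness then also has bound [U],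
    while a pruned one would give [L >= v = U]. *)
Lemma selectable_leaf s : state_ok s none -> glob_ok s -> (globL s < globU s)%E ->
  exists P, [/\ P \in leaves (tree s), P \notin pruned s & ub s P = globU s].
Proof.
move=> ok gl LU; have vU := v_le_globU ok gl.
have [P leafP PU] := globU_attained ok gl.
case: (boolP (P \in pruned s)) => Ppr; last by exists P.
have [_ _] := ok_pruned ok Ppr; rewrite PU => Uv.
have UE : globU s = v by apply/eqP; rewrite eq_le Uv vU.
case: (ok_witness ok) => -[Q [leafQ Qpr Qw]]; last first.
  have := lb_le_globL gl leafQ; rewrite Qw -UE.
  by rewrite leNgt LU.
exists Q; split=> //; apply/eqP; rewrite eq_le ub_le_globU//= UE.
have [x Qx <-] := Qw; exact: f_le_ub (leaf_ok ok leafQ) Qx.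
Qed.

Lemma config_progress c : config_ok c ->
  (exists c', step a b X c c') \/ exists o, c = Returned I o.
Proof.
case: c => [s|s P|s P k|s C|s|o] /=.
- move=> [ok gl LU]; left; have [P [leafP Ppr PU]] := selectable_leaf ok gl LU.
  exists (Selected s P); apply: step_select => // P' leafP'.
  by rewrite PU; exact: ub_le_globU.
- by move=> [_ _ _ [k kP]]; left; exists (Chosen s P k); exact: step_choose.
- by move=> _; left; eexists; exact: step_branch.
- move=> [ok CT rC _]; left.
  (* All LP solutions are chosen at once; off [C] the pair [(0, 0)] is a dummy. *)
  have /choice[tx txP] P : exists tx, P \in C -> lp_optimal a b X P tx.1 tx.2.
    case: (boolP (P \in C)) => [PC|_]; last by exists (0, 0).
    have Pne := tree_nonempty (ok_tree ok) (fintype.subsetP CT P PC).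
    have [|theta [x opt]] := lp_optimum_exists polytopeX _ Pne.
      by apply: contraNneq rC; rewrite -/root => <-.
    by exists (theta, x).
  exists (Evaluated (set_bounds a b s C (fun P => (tx P).1) (fun P => (tx P).2))).
  exact: step_evaluate.
- move=> _; left; have [h|h] := pselect (exists2 P, P \in leaves (tree s) & lb s P = globU s).
    by have [P leafP PU] := h; exists (Returned I (pt s P)); exact: step_stop.
  exists (Loop (prune s)); apply: step_prune => P leafP PU; apply: h; by exists P.
- by move=> _; right; exists o.
Qed.

(* Each round of five transitions adds a node to the tree. *)
Definition fuel (c : config R n I) : nat :=
  let left s := (5 * #|~: tree s|)%N in
  match c with
  | Loop s => left s + 4
  | Selected s P => left s + 3
  | Chosen s P k => left s + 2
  | Branched s C => left s + 6
  | Evaluated s => left s + 5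
  | Returned o => 0
  end%N.

Lemma step_fuel c c' : config_ok c -> step a b X c c' -> (fuel c' < fuel c)%N.
Proof.
move=> okc st; case: st okc => {c c'} /=.
- by move=> s _ _; rewrite addnS.
- by move=> s P _ _ _ _ _; rewrite ltn_add2l.
- by move=> s P k _ _; rewrite ltn_add2l.
- move=> s P k [ok leafP Ppr kP].
  have [x Px] := tree_nonempty (ok_tree ok) (leaf_tree leafP).
  have [C Cch _] := children_cover I_gt0 k Px.
  (* Each node leaving the complement saves 5, one more than the rise from 2 to 6. *)
  suff h : (#|~: (tree s :|: children P k)| < #|~: tree s|)%N.
    have := leq_mul (leqnn 5) h; rewrite mulnS -(leq_add2r 2); apply: leq_trans.
    by rewrite addnAC addnC.
  apply: proper_card; rewrite finset.setCU; apply/properP; split.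
    exact: finset.subsetIl.
  exists C; first by rewrite inE (child_notin leafP kP Cch).
  by rewrite !inE Cch andbF.
- by move=> s C theta x _ _; rewrite ltn_add2l.
- by move=> s P _ _ _; rewrite addnS.
- by move=> s _ _; rewrite ltn_add2l.
Qed.

Lemma no_infinite_run (c : nat -> config R n I) :
  config_ok (c 0%N) -> ~ (forall t, step a b X (c t) (c t.+1)).
Proof.
move=> ok0 st.
have ok t : config_ok (c t) by elim: t => // t IHt; exact: step_config_ok IHt (st t).
have fuel_le t : (fuel (c t) + t <= fuel (c 0%N))%N.
  elim: t => [|t IHt]; first by rewrite addn0.
  by apply: leq_trans IHt; rewrite addnS -addSn leq_add2r; exact: step_fuel.
have := fuel_le (fuel (c 0%N)).+1.
by rewrite leqNgt addnS ltnS leq_addl.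
Qed.

End Algorithm.

(** Both parts range over all choices; together they say that every maximal run is finite and ends
    by returning a maximizer. *)
Theorem theorem2p1 (R : realType) (n K : nat) (I : 'I_K -> nat)
    (a : forall k : 'I_K, 'I_(I k) -> 'rV[R]_n)
    (b : forall k : 'I_K, 'I_(I k) -> R)
    (X : set 'rV[R]_n)
    (polytopeX : polytope X) (X_neq0 : exists x, X x)
    (K_gt0 : (0 < K)%N) (I_gt0 : forall k : 'I_K, (0 < I k)%N) :
  (~ exists c : nat -> config R n I,
       c 0%N = init R n I /\ forall t : nat, step a b X (c t) (c t.+1))
  /\
  (forall c : config R n I, reachable a b X c ->
     (forall c' : config R n I, ~ step a b X c c') ->
     exists x : 'rV[R]_n, c = Returned I (Some x) /\ global_maximizer a b X x).
Proof.
have [x [Xx v_ub]] := global_maximizer_exists a b polytopeX X_neq0 K_gt0 I_gt0.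
have v_attained : exists2 y, X y & f a b y = f a b x by exists x.
have ok_init := config_ok_init X_neq0 v_attained.
split=> [[c [c0 st]]|c reach stuck].
  by apply: (no_infinite_run X_neq0 K_gt0 I_gt0 v_ub v_attained _ st); rewrite c0.
have okc : config_ok a b X (f a b x) c.
  (* The closure is read as appending steps at the end, so that the invariant travels forward from
     [init]. *)
  elim: (clos_rt_rtn1 _ _ _ _ reach) => // c1 c2 st _ ok1.
  exact: (step_config_ok X_neq0 K_gt0 I_gt0 v_ub v_attained ok1 st).
have [[c' /stuck//]|[y cE]] :=
  config_progress polytopeX X_neq0 K_gt0 I_gt0 v_attained okc.
by move: okc; rewrite cE => -[z -> zmax]; exists z.
Qed.
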